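(* Let $G$ be a compact-bounded paratopological group such that the set $K^{-1}=\{x^{-1}:x\in K\}$ is countably compact in $G$ for each compact subset $K\subset G$. Suppose that at least one of the following conditions holds: (1) $G$ is left $\omega$-precompact; (2) $G$ is topologically periodic; (3) $G$ has countable pseudocharacter. Then $G$ is a topological group.
   Context: All topological spaces (in particular all paratopological groups) are assumed to be Hausdorff. A paratopological group is a group with a topology for which multiplication is jointly continuous. A space $X$ is compact-bounded if for every countable family $\mathcal U$ of non-empty open subsets of $X$ there is a compact $K\subset X$ which meets each element of $\mathcal U$. ''$K^{-1}$ is countably compact in $G$'' means that $K^{-1}$, with the subspace topology from $G$, is countably compact. $G$ is left $\omega$-precompact if for each neighborhood $U$ of the identity there is a countable $F\subset G$ with $FU=G$. $G$ is topologically periodic if for each $x\in G$ and each neighborhood $U$ of the identity there is an integer $n\ge 1$ with $x^n\in U$. $G$ has countable pseudocharacter if every one-point subset of $G$ is the intersection of countably many open subsets of $G$. *)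

(* Defs.v *)
From HB Require Import structures.
From mathcomp Require Import all_boot.
From mathcomp Require Import boolp classical_sets functions cardinality.
From mathcomp Require Import topology.

Set Implicit Arguments.
Unset Strict Implicit.
Unset Printing Implicit Defensive.

Local Open Scope group_scope.
Local Open Scope classical_set_scope.

(* No compatibility between the group and the topology is required here. *)
#[short(type="preTopologicalGroupType")]
HB.structure Definition PreTopologicalGroup := {G of Topological G & Group G}.

Section Spaces.
Variable X : topologicalType.

Definition countably_compact_space : Prop :=
  forall F : set (set X), countable F -> F `<=` open ->
    \bigcup_(U in F) U = [set: X] ->
  exists E : set (set X),
    [/\ finite_set E, E `<=` F & \bigcup_(U in E) U = [set: X]].

Definition compact_bounded : Prop :=
  forall F : set (set X), countable F ->
    (forall U, F U -> open U /\ U !=set0) ->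
  exists2 K : set X, compact K & forall U, F U -> K `&` U !=set0.

Definition countable_pseudocharacter : Prop :=
  forall x : X, exists F : set (set X),
    [/\ countable F, F `<=` open & \bigcap_(U in F) U = [set x]].

End Spaces.

Section Groups.
Variable G : preTopologicalGroupType.

Definition paratopological_group : Prop :=
  continuous (fun z : (G * G)%type => z.1 * z.2 : G).

Definition topological_group : Prop :=
  paratopological_group /\ continuous (fun x : G => x^-1 : G).

Definition inv_set (K : set G) : set G := [set x^-1 | x in K].

Definition left_omega_precompact : Prop :=
  forall U : set G, nbhs (1 : G) U ->
  exists2 F : set G, countable F & [set x * y | x in F & y in U] = [set: G].

Definition topologically_periodic : Prop :=
  forall (x : G) (U : set G), nbhs (1 : G) U ->
  exists2 n : nat, (1 <= n)%N & U (x ^+ n).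

End Groups.

Arguments countably_compact_space : clear implicits.
Arguments compact_bounded : clear implicits.
Arguments countable_pseudocharacter : clear implicits.
Arguments paratopological_group : clear implicits.
Arguments topological_group : clear implicits.
Arguments left_omega_precompact : clear implicits.
Arguments topologically_periodic : clear implicits.

(* Main.v *)
(**
If [K] is compact and [K^-1] is countably compact, any sequence [k_n] in [K]
has a point [a] such that [(k_n, k_n^-1)] clusters at [(a, a^-1)]. With
compact-boundedness this has two consequences: for decreasing nonempty open
[O_n] the closures of the [O_n^-1] have a common point; and any sequence of
nonempty open sets [O_n] contains points [k_n] for which [k_m^-1 k_n] is
arbitrarily close to [1] for some [n < m]. The second one shows that
[(closure U)^-1] is a neighbourhood of [1] whenever [U] is.

Under left omega-precompactness, the first consequence gives a Baire-type
argument by which every [U^-1] has interior points; as [V^-1] is contained in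
[closure U] for small [V], one of them lies in [U], whence [(U^-1)(U^-1)] is a
neighbourhood of [1]. In the other two cases suppose that [U^-1] is not a
neighbourhood of [1]; the first consequence applied to
[V_n \ closure (V_1^-1)] gives [y] outside [V_1] with [y^-1] in all [V_n].
Countable pseudocharacter forces [y = 1], while for [y^n] close to [1] we get
[y = y^n (y^-1)^(n-1)] in [V_1].
*)

Require Import Defs.
From HB Require Import structures.
From mathcomp Require Import all_boot.
From mathcomp Require Import boolp classical_sets functions cardinality.
From mathcomp Require Import topology.

Set Implicit Arguments.
Unset Strict Implicit.
Unset Printing Implicit Defensive.

Local Open Scope group_scope.
Local Open Scope classical_set_scope.

(** * Finite bounds, enumerations and cluster points *)

Lemma seq_bounded_index (T : eqType) (s : seq T) (P : T -> nat -> Prop) :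
  (forall x, x \in s -> exists n, P x n) ->
  (forall x m n, (m <= n)%N -> P x m -> P x n) ->
  exists n, forall x, x \in s -> P x n.
Proof.
move=> + Pmono; elim: s => [|y s IHs] sP; first by exists 0%N.
have [n Pn] : exists n, P y n by apply: sP; rewrite mem_head.
have [m Pm] : exists m, forall x, x \in s -> P x m.
  by apply: IHs => x xs; apply: sP; rewrite inE xs orbT.
exists (maxn n m) => x; rewrite inE => /orP[/eqP->|xs].
  by apply: Pmono Pn; rewrite leq_maxl.
by apply: Pmono (Pm _ xs); rewrite leq_maxr.
Qed.

(** The value [x0] fills the indices that code no element, so [A] may be empty. *)
Lemma countable_enum (T : Type) (A : set T) (x0 : T) : countable A ->
  exists f : nat -> T, (forall n, A (f n) \/ f n = x0) /\
    forall x, A x -> exists n, f n = x.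
Proof.
move=> /countable_injP[g ginj].
have /choice[f fP] : forall n, exists x, (A x \/ x = x0) /\
    forall y, A y -> g y = n -> x = y.
  move=> n; have [[x Ax <-]|nA] := pselect (exists2 x, A x & g x = n).
    exists x; split; first by left.
    by move=> y Ay gyx; apply: ginj; rewrite ?inE.
  by exists x0; split; [right|move=> y Ay gyn; case: nA; exists y].
exists f; split=> [n|x Ax]; first by case: (fP n).
by exists (g x); case: (fP (g x)) => _; exact.
Qed.

(** Without a cluster point the complements of the closed tails form an increasing open cover of
    [B]. One of them, [D N], would then be everything although it misses [l N]. *)
Lemma countably_compact_cluster (X : topologicalType) (B : set X)
    (l : nat -> X) :
  countably_compact_space (set_type B) -> (forall n, B (l n)) ->
  exists2 b, B b &
    forall M, nbhs b M -> forall n0, exists2 n, (n0 <= n)%N & M (l n).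
Proof.
move=> ccB Bl; apply: contrapT => noclust.
pose tail n := [set l m | m in [set m | (n <= m)%N]].
pose D n : set (set_type B) := set_val @^-1` (~` closure (tail n)).
have Dmono m n : (m <= n)%N -> D m `<=` D n.
  move=> mn x /= nx; apply: contra_not nx => /=.
  by apply: closureS => _ [i /= ni <-]; exists i => //=; exact: leq_trans ni.
have [] := ccB (range D).
- exact: sub_countable (card_image_le _ _) (countableP _).
- move=> _ [n _ <-]; apply: open_comp.
    by move=> x _; exact: initial_continuous.
  by apply: closed_openC; exact: closed_closure.
- rewrite -subTset => x _; apply: contrapT => xD; apply: noclust.
  exists (set_val x); first by apply: set_mem; exact: valP.
  move=> M Mx n0; apply: contrapT => noM; apply: xD.
  exists (D n0); first by exists n0.
  move=> /(_ _ Mx)[_ [[m /= n0m <-] Mlm]].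
  by apply: noM; exists m.
move=> E [/finite_seqP[s ->] sD cover].
have [||N DN] := @seq_bounded_index _ s (fun U n => U `<=` D n).
- by move=> U /sD[n _ <-]; exists n.
- by move=> U m n /Dmono mn Um; exact: subset_trans Um mn.
have : D N (SigSub (mem_set (Bl N))).
  have : [set: set_type B] (SigSub (mem_set (Bl N))) by [].
  by rewrite -cover => -[U Us Ux]; exact: (DN U).
apply; rewrite /= set_valE /=; apply: subset_closure.
by exists N => /=.
Qed.

Section Inverse.
Variable G : preTopologicalGroupType.

Lemma inv_setE (U : set G) (x : G) : inv_set U x = U x^-1.
Proof.
rewrite propeqE; split=> [[y Uy <-]|Ux]; first by rewrite invgK.
by exists x^-1; rewrite ?invgK.
Qed.

End Inverse.

(** * Neighbourhoods and closures under joint continuity alone *)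

Section Paratopological.
Variable G : preTopologicalGroupType.
Hypothesis paraG : paratopological_group G.

Lemma nbhs_mulg (x y : G) (N : set G) : nbhs (x * y) N ->
  exists A B, [/\ nbhs x A, nbhs y B & forall a b, A a -> B b -> N (a * b)].
Proof.
move=> Nxy; have [[A B] /= [Ax By] ABN] := @paraG (x, y) _ Nxy.
by exists A, B; split=> // a b Aa Bb; exact: (ABN (a, b)).
Qed.

Lemma nbhs_mulgl (x y : G) (N : set G) :
  nbhs (x * y) N -> nbhs y [set b | N (x * b)].
Proof.
move=> /nbhs_mulg[A [B [Ax By ABN]]]; apply: filterS By => b.
by apply: ABN; exact: nbhs_singleton.
Qed.

Lemma nbhs_mulgr (x y : G) (N : set G) :
  nbhs (x * y) N -> nbhs x [set a | N (a * y)].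
Proof.
move=> /nbhs_mulg[A [B [Ax By ABN]]]; apply: filterS Ax => a Aa.
by apply: ABN => //; exact: nbhs_singleton.
Qed.

Lemma nbhs_half (U : set G) : nbhs 1 U ->
  exists V : set G, [/\ open V, V 1 & forall a b, V a -> V b -> U (a * b)].
Proof.
rewrite -[X in nbhs X U](mulg1 1) => /nbhs_mulg[A [B [A1 B1 ABU]]].
exists ((A `&` B)°); split; first exact: open_interior.
  exact: filterI.
by move=> a b /interior_subset[Aa _] /interior_subset[_ Bb]; exact: ABU.
Qed.

(** The sets [B n] let the halvings shrink into a prescribed sequence of neighbourhoods, as
    countable pseudocharacter requires. *)
Lemma nbhs_half_seq (U : set G) (B : nat -> set G) :
  nbhs 1 U -> (forall n, nbhs 1 (B n)) ->
  exists V : nat -> set G, [/\ V 0 `<=` U, forall n, open (V n) /\ V n 1 &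
    forall n a b, V n.+1 a -> V n.+1 b -> (V n `&` B n) (a * b)].
Proof.
move=> U1 B1.
have /choice[h hP] : forall W : set G, exists V : set G, nbhs 1 W ->
    [/\ open V, V 1 & forall a b, V a -> V b -> W (a * b)].
  move=> W; have [/nbhs_half[V VP]|nW] := pselect (nbhs 1 W); first by exists V.
  by exists setT => /nW.
pose V := fix V n := if n is n'.+1 then h (V n' `&` B n') else h U.
have VP n : open (V n) /\ V n 1.
  elim: n => [|n [Vo Vn1]]; first by have [] := hP _ U1.
  by have [] := hP _ (filterI (open_nbhs_nbhs (conj Vo Vn1)) (B1 n)).
exists V; split=> //.
  have [_ h1 hU] := hP _ U1.
  by move=> x Vx; rewrite -[x]mulg1; exact: hU.
move=> n a b; have [Vo Vn1] := VP n.
by have [_ _] := hP _ (filterI (open_nbhs_nbhs (conj Vo Vn1)) (B1 n)); apply.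
Qed.

(** The translate [x V] is a neighbourhood of [x], so it contains some [a^-1] with [a] in [A]. Hence
    taking the closure of [A^-1] costs only one extra factor from [V^-1]. *)
Lemma closure_inv_set (A V : set G) (x : G) : nbhs 1 V ->
  closure (inv_set A) x -> exists a v, [/\ A a, V v & x = a^-1 * v^-1].
Proof.
move=> V1 clx.
have /clx[_ [[a Aa <-] /= Vxa]] : nbhs x [set y | V (x^-1 * y)].
  by apply: nbhs_mulgl; rewrite mulVg.
by exists a, (x^-1 * a^-1); split=> //; rewrite invgM !invgK mulKg.
Qed.

Lemma closure_inv_setr (A V : set G) (x : G) : nbhs 1 V ->
  closure (inv_set A) x -> exists a v, [/\ A a, V v & x = v^-1 * a^-1].
Proof.
move=> V1 clx.
have /clx[_ [[a Aa <-] /= Vxa]] : nbhs x [set y | V (y * x^-1)].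
  by apply: nbhs_mulgr; rewrite mulgV.
by exists a, (a^-1 * x^-1); split=> //; rewrite invgM !invgK mulgK.
Qed.

Lemma nbhs_inv_continuous :
  (forall U : set G, nbhs 1 U -> nbhs 1 (inv_set U)) ->
  continuous (fun x : G => x^-1 : G).
Proof.
move=> invN x N Nx.
have /invN : nbhs (1 : G) [set u | N (u * x^-1)].
  by apply: nbhs_mulgr; rewrite mul1g.
rewrite -[X in nbhs X _](mulVg x) => /nbhs_mulgl inv_x.
by apply: filterS inv_x => z; rewrite /= inv_setE /= invgM invgK mulgK.
Qed.

(** * Sequences clustering together with their inverses *)

Hypothesis hausG : hausdorff_space G.

(** Countable compactness gives a cluster point [b] of the inverses. The filter [F] plays the role
    of a subsequence of [k] whose inverses tend to [b], and compactness of [K] gives it a cluster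
    point [a]. As [k_n k_n^-1 = 1], the product [a b] cannot be separated from [1]. *)
Lemma inv_cluster (K : set G) (k : nat -> G) :
  compact K -> countably_compact_space (set_type (inv_set K)) ->
  (forall n, K (k n)) ->
  exists a, forall N M, nbhs a N -> nbhs a^-1 M ->
    forall n0, exists n, [/\ (n0 <= n)%N, N (k n) & M (k n)^-1].
Proof.
move=> cK ccK Kk.
have [|b _ clb] := @countably_compact_cluster _ _ (fun n => (k n)^-1) ccK.
  by move=> n; rewrite inv_setE invgK.
pose F : set_system G := [set S | exists M n0, nbhs b M /\
  forall n, (n0 <= n)%N -> M (k n)^-1 -> S (k n)].
have FF : ProperFilter F.
  split.
    move=> [M [n0 [Mb MP]]]; have [n n0n Mn] := clb _ Mb n0; exact: MP Mn.
  split.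
  - by exists setT, 0%N; split=> //; exact: filterT.
  - move=> P Q [M [m [Mb MP]]] [N [n [Nb NQ]]].
    exists (M `&` N), (maxn m n); split; first exact: filterI.
    move=> i; rewrite geq_max => /andP[mi ni] [Mi Ni].
    by split; [exact: MP|exact: NQ].
  - move=> P Q PQ [M [m [Mb MP]]]; exists M, m; split=> // n mn Mn.
    exact/PQ/MP.
have [|a [_ cla]] := cK F FF.
  by exists setT, 0%N; split=> //; exact: filterT.
have joint N M : nbhs a N -> nbhs b M ->
    forall n0, exists n, [/\ (n0 <= n)%N, N (k n) & M (k n)^-1].
  move=> Na Mb n0.
  have FS : F [set k n | n in [set n | (n0 <= n)%N /\ M (k n)^-1]].
    by exists M, n0; split=> // n n0n Mn; exists n.
  by have [_ [[n [n0n Mn] <-] Nn]] := cla _ _ FS Na; exists n.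
suff ab : a^-1 = b by exists a; rewrite ab.
apply: mulg1_eq; apply: hausG => P Q Pab Q1.
have [N [M [Na Mb NMP]]] := nbhs_mulg Pab.
have [n [_ Nn Mn]] := joint _ _ Na Mb 0%N.
exists 1; split; last exact: nbhs_singleton.
by rewrite -(mulgV (k n)); exact: NMP.
Qed.

(** * Consequences of compact-boundedness *)

Hypothesis cbG : compact_bounded G.
Hypothesis ccinv : forall K : set G, compact K ->
  countably_compact_space (set_type (inv_set K)).

Lemma open_seq_inv_cluster (O : nat -> set G) :
  (forall n, open (O n) /\ O n !=set0) ->
  exists (k : nat -> G) (a : G), (forall n, O n (k n)) /\
    forall N M, nbhs a N -> nbhs a^-1 M ->
    forall n0, exists n, [/\ (n0 <= n)%N, N (k n) & M (k n)^-1].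
Proof.
move=> OP.
have [||K cK KO] := cbG (F := range O).
  exact: sub_countable (card_image_le _ _) (countableP _).
  by move=> _ [n _ <-].
have /choice[k kP] : forall n, exists x, K x /\ O n x.
  by move=> n; have /KO[x KOx] : range O (O n) by []; exists x.
have [|a aP] := @inv_cluster K k cK (ccinv cK); first by move=> n; case: (kP n).
by exists k, a; split=> // n; case: (kP n).
Qed.

Lemma decreasing_inv_closure (O : nat -> set G) :
  (forall n, open (O n) /\ O n !=set0) ->
  (forall n, O n.+1 `<=` O n) ->
  exists x, forall n, closure (inv_set (O n)) x.
Proof.
move=> OP Odec; have [k [a [Ok aP]]] := open_seq_inv_cluster OP.
have Ole m n : (m <= n)%N -> O n `<=` O m.
  elim: n => [|n IHn]; first by rewrite leqn0 => /eqP->.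
  rewrite leq_eqVlt => /orP[/eqP->//|/IHn Omn].
  by apply: subset_trans Omn; exact: Odec.
exists a^-1 => n M Ma.
have [m [nm _ Mm]] := aP _ _ (@filterT _ (nbhs a) _) Ma n.
by exists (k m)^-1; split=> //; exists (k m) => //; apply: Ole nm _ _.
Qed.

(** Otherwise removing the closures of the [A_n^-1] one by one leaves nonempty open sets [O_n]. A
    point common to the closures of the [O_n^-1] lies in some [A_n], which then meets [O_{n+1}^-1],
    although [O_{n+1}] avoids [A_n^-1]. *)
Lemma inv_baire (A : nat -> set G) :
  (forall n, open (A n)) -> (forall x, exists n, A n x) ->
  exists n, (closure (inv_set (A n)))° !=set0.
Proof.
move=> Aopen Acover; apply: contrapT => noint.
pose O := fix O n :=
  if n is m.+1 then O m `\` closure (inv_set (A m)) else setT.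
have OP n : open (O n) /\ O n !=set0.
  elim: n => [|n [On [x Onx]]]; first by split; [exact: openT|exists 1].
  split; first by apply: openI => //; exact/closed_openC/closed_closure.
  apply: contrapT => O0; apply: noint; exists n, x.
  apply: filterS (open_nbhs_nbhs (conj On Onx)) => y Ony.
  by apply: contrapT => Any; apply: O0; exists y.
have [|x xP] := decreasing_inv_closure OP; first by move=> n y [].
have [n Anx] := Acover x.
have [_ [[y [_ nAy] <-] Any]] :=
  xP n.+1 _ (open_nbhs_nbhs (conj (Aopen n) Anx)).
by apply/nAy/subset_closure; rewrite inv_setE.
Qed.

(** Otherwise there are [x_n] in [V_{n+1}] and neighbourhoods [T_n] of [1] with [x_n^-1 T_n]
    disjoint from [U]. Clustering is applied to the sets [y_n T_n], where [y_n = x_0 ... x_{n-1}]: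
    for [n < m] the element [y_{n+1}^-1 k_m] is small, so [k_m^-1 k_n] in [W] would bring a point of
    [x_n^-1 T_n] into [U]. *)
Lemma nbhs_inv_closure (U : set G) : nbhs 1 U -> nbhs 1 (inv_set (closure U)).
Proof.
move=> U1; apply: contrapT => nU.
have [W [Wo W1 WU]] := nbhs_half U1.
have W1n := open_nbhs_nbhs (conj Wo W1).
have [V [VW VP V2]] := nbhs_half_seq W1n (fun=> @filterT _ (nbhs (1 : G)) _).
have Vdec n : V n `<=` W.
  elim: n => [//|n IHn] z Vz; apply: IHn; rewrite -[z]mulg1.
  by have [] := V2 n _ _ Vz (VP n.+1).2.
have step n : exists x T, [/\ V n.+1 x, open T, T 1, T `<=` V n &
    forall t u, T t -> U u -> u <> x^-1 * t].
  apply: contrapT => nstep; apply: nU.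
  have [Vo V1] := VP n.+1.
  apply: filterS (open_nbhs_nbhs (conj Vo V1)) => x Vx.
  rewrite inv_setE => N; rewrite nbhsE => -[N' [N'o N'x] N'N].
  have [VNo VN1] := VP n.
  apply: contrapT => dis; apply: nstep.
  exists x, (V n `&` ([set t | N' (x^-1 * t)])°); split=> //.
  - by apply: openI => //; exact: open_interior.
  - split=> //; apply: nbhs_mulgl; rewrite mulg1.
    exact: open_nbhs_nbhs.
  - by move=> t u [_ /interior_subset N't] Uu e; apply: dis; exists u;
      split=> //; apply: N'N; rewrite e.
have [x xP] := choice step; have [T TP] := choice xP => {xP step}.
pose y := fix y n := if n is m.+1 then y m * x m else 1 : G.
(* Here [(y n)^-1 * y (n + j)] is [x_n ... x_{n+j-1}]; its factors are absorbed from the right, each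
   product moving one halving up. *)
have yV j n z : V (n + j) z -> V n ((y n)^-1 * (y (n + j) * z)).
  elim: j z => [|j IHj] z; first by rewrite addn0 mulKg.
  rewrite addnS /= => Vz; rewrite -mulgA; apply: IHj.
  have [Vx _ _ _ _] := TP (n + j)%N.
  by have [] := V2 _ _ _ Vx Vz.
have [|k [a [Ok aP]]] := @open_seq_inv_cluster
    (fun n => ([set z | T n ((y n)^-1 * z)])°).
  move=> n; split; first exact: open_interior.
  have [_ To T1 _ _] := TP n; exists (y n); apply: nbhs_mulgl.
  by rewrite mulVg; exact: open_nbhs_nbhs.
have {}Ok n : T n ((y n)^-1 * k n) by exact: interior_subset (Ok n).
have [] : exists n m, [/\ (n < m)%N & W ((k m)^-1 * k n)].
  rewrite -(mulVg a) in W1.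
  have [A [B [Aa Ba ABW]]] := nbhs_mulg (open_nbhs_nbhs (conj Wo W1)).
  have [n [_ Bn _]] := aP _ _ Ba Aa 0%N.
  have [m [nm _ Am]] := aP _ _ Ba Aa n.+1.
  by exists n, m; split=> //; exact: ABW.
move=> n [m [nm Wmn]].
have [_ _ _ _ dis] := TP n; have [_ _ _ TV _] := TP m.
(* [x_n^-1 (y_n^-1 k_n) = (y_{n+1}^-1 k_m) (k_m^-1 k_n)] lies in [W W]. *)
have Wk : W ((y n.+1)^-1 * k m).
  have /yV : V (n.+1 + (m - n.+1))%N ((y m)^-1 * k m).
    by rewrite subnKC //; exact: TV.
  by rewrite subnKC // mulVKg => /Vdec.
apply: (dis _ _ (Ok n) (WU _ _ Wk Wmn)).
by rewrite /= invgM !mulgA mulgK.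
Qed.

(** * The three sufficient conditions *)

Lemma open_mulgl (x : G) (V : set G) : open V -> open [set y | V (x * y)].
Proof.
move=> Vo; rewrite openE => y Vxy; apply: nbhs_mulgl.
exact: open_nbhs_nbhs.
Qed.

(** Intersecting [V] with [(closure V)^-1] forces the interior point into [closure V], so the
    interior of [V^-1] meets [V] at some [a]. For [t] near [1] then [a t] is in [V^-1], and
    [t^-1 = (a t)^-1 a] is in [V V]. *)
Lemma nbhs_inv_of_interior :
  (forall U : set G, nbhs 1 U -> (inv_set U)° !=set0) ->
  forall U : set G, nbhs 1 U -> nbhs 1 (inv_set U).
Proof.
move=> intinv U /nbhs_half[V [Vo V1 VVU]].
have V1n := open_nbhs_nbhs (conj Vo V1).
have [x xint] := intinv _ (filterI V1n (nbhs_inv_closure V1n)).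
have := interior_subset xint; rewrite inv_setE => -[_].
rewrite inv_setE invgK.
move=> /(_ _ (open_nbhs_nbhs (conj (@open_interior _ _) xint)))[a [Va aint]].
rewrite /interior /= -[X in nbhs X _]mulg1 in aint.
apply: filterS (nbhs_mulgl aint) => t; rewrite /= !inv_setE invgM => -[Vt _].
by rewrite -[t^-1](mulgVK a); exact: VVU.
Qed.

(** The Baire argument applies to the cover by the [f_n V]. The closure of [(f_n V)^-1] lies in
    [V^-1 V^-1 f_n^-1], and right translation by [f_n] removes the last factor. *)
Lemma left_omega_precompact_interior (U : set G) :
  left_omega_precompact G -> nbhs 1 U -> (inv_set U)° !=set0.
Proof.
move=> wG /nbhs_half[V [Vo V1 VVU]].
have V1n := open_nbhs_nbhs (conj Vo V1).
have [F cF FV] := wG _ V1n.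
have [f [_ fF]] := countable_enum 1 cF.
have [||n [y yint]] := @inv_baire (fun n => [set z | V ((f n)^-1 * z)]).
- by move=> n; exact: open_mulgl.
- move=> x; have : [set: G] x by [].
  rewrite -FV => -[z /fF[n <-] [v Vv <-]]; exists n.
  by rewrite /= mulKg.
rewrite -(mulgK (f n) y) /interior /= in yint.
exists (y * f n); apply: filterS (nbhs_mulgr yint).
move=> z /(closure_inv_setr V1n)[a [v [Va Vv zE]]].
by rewrite inv_setE -[z](mulgVK (f n)) zE !invgM !invgK mulgA; exact: VVU.
Qed.

Lemma not_nbhs_inv (U : set G) (B : nat -> set G) :
  nbhs 1 U -> (forall n, nbhs 1 (B n)) -> ~ nbhs 1 (inv_set U) ->
  exists (V : nat -> set G) (y : G), [/\ forall n, open (V n) /\ V n 1,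
    forall n a b, V n.+1 a -> V n.+1 b -> V n (a * b), ~ V 0 y &
    forall n, (V n `&` B n) y^-1].
Proof.
move=> U1 B1 nU.
have [V [VU VP V2]] := nbhs_half_seq U1 B1.
have Vn1 n := open_nbhs_nbhs (VP n).
have VS n : V n.+1 `<=` V n.
  by move=> z Vz; have [] := V2 n _ _ Vz (VP n.+1).2; rewrite mulg1.
pose O n := V n `\` closure (inv_set (V 1%N)).
have [||y clO] := @decreasing_inv_closure O.
- move=> n; split.
    by apply: openI (VP n).1 _; exact/closed_openC/closed_closure.
  (* If [O n] were empty, [V n] would lie in the closure of [V_1^-1], hence in [(V_1 V_1)^-1] and in
     [U^-1]. *)
  apply: contrapT => O0; apply: nU; apply: filterS (Vn1 n) => x Vx.
  have /(closure_inv_set (Vn1 1%N))[a [v [Va Vv ->]]] :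
      closure (inv_set (V 1%N)) x.
    by apply: contrapT => nx; apply: O0; exists x.
  by rewrite inv_setE invgM !invgK; apply: VU; have [] := V2 0 _ _ Vv Va.
- by move=> n x [/VS].
(* The shift makes [V 1], the set that [y] avoids, the first term. *)
exists (V \o S), y; split.
- by move=> n; exact: VP.
- by move=> n a b Va Vb; have [] := V2 n.+1 _ _ Va Vb.
- move=> /= Vy; have [_ [[x [_ nx] <-] Vx]] :=
    clO 0 _ (open_nbhs_nbhs (conj (VP 1%N).1 Vy)).
  by apply/nx/subset_closure; rewrite inv_setE.
(* The product [v a] falls in [V n.+1], but only with [B n.+1]; a further product with [1] gives
   [B n]. *)
- move=> n; have [a [v [[Va _] Vv ->]]] :=
    closure_inv_set (Vn1 n.+2) (clO n.+2).
  rewrite invgM !invgK; have [V' _] := V2 n.+1 _ _ Vv Va.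
  by have [] := V2 n _ _ V' (VP n.+1).2; rewrite mulg1.
Qed.

Lemma topologically_periodic_inv (U : set G) :
  topologically_periodic G -> nbhs 1 U -> nbhs 1 (inv_set U).
Proof.
move=> tpG U1; apply: contrapT => nU.
have [V [y [VP V2 nVy Vy]]] :=
  not_nbhs_inv U1 (fun=> @filterT _ (nbhs (1 : G)) _) nU.
have Vpow k n : V n ((y^-1) ^+ k).
  elim: k n => [|k IHk] n; first by rewrite expg0; exact: (VP n).2.
  by rewrite expgS; apply: V2 => //; exact: (Vy n.+1).1.
have [[//|n] _ Vn] := tpG y _ (open_nbhs_nbhs (VP 1%N)).
apply: nVy; have -> : y = y ^+ n.+1 * (y^-1) ^+ n.
  by rewrite expVgn expgS mulgK.
exact: V2.
Qed.

Lemma countable_pseudocharacter_inv (U : set G) :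
  countable_pseudocharacter G -> nbhs 1 U -> nbhs 1 (inv_set U).
Proof.
move=> /(_ 1)[F [cF Fo F1]] U1; apply: contrapT => nU.
have FI A : F A -> A 1.
  by move=> FA; have : [set (1 : G)] 1 by []; rewrite -F1; apply.
(* The default [setT] keeps every [f n] a neighbourhood of [1]. *)
have [f [Ff fF]] := countable_enum setT cF.
have f1 n : nbhs 1 (f n).
  have [Ffn|->] := Ff n; last exact: filterT.
  by apply: open_nbhs_nbhs; split; [exact: Fo|exact: FI].
have [V [y [VP V2 nVy Vy]]] := not_nbhs_inv U1 f1 nU.
have : [set (1 : G)] y^-1.
  by rewrite -F1 => A /fF[n <-]; exact: (Vy n).2.
move=> y1; apply: nVy; rewrite -[y]invgK y1 invg1; exact: (VP 0).2.
Qed.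

End Paratopological.

Theorem corollary3p4 (G : preTopologicalGroupType)
  (hausG : hausdorff_space G)
  (paraG : paratopological_group G)
  (cbG : compact_bounded G)
  (ccinv : forall K : set G, compact K ->
     countably_compact_space (set_type (inv_set K)))
  (cond : left_omega_precompact G \/ topologically_periodic G \/
          countable_pseudocharacter G) :
  topological_group G.
Proof.
split=> //; apply: nbhs_inv_continuous => //.
case: cond => [wG|[tpG|cpG]] U.
- apply: nbhs_inv_of_interior => // W; exact: left_omega_precompact_interior.
- exact: topologically_periodic_inv.
- exact: countable_pseudocharacter_inv.
Qed.
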